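(* Let $\Theta=\{(a_n)_{n=1}^\infty\in S_{\ell_1}: a_1=0\}$. Then $\Theta$ is exactly the set of points of continuity of the identity map $I:(B_{\ell_1},w^*(c))\to (B_{\ell_1},w)$.
   Context: $c$ is the Banach space of convergent real sequences $(\alpha_n)_{n\ge 1}$ with the sup norm. $\ell_1$ is identified isometrically with $c^*$ by letting $(a_n)_{n=1}^\infty\in\ell_1$ act on $(\alpha_n)_{n\geq 1}\in c$ by $a_1\lim_n\alpha_n+\sum_{n=1}^\infty a_{n+1}\alpha_n$. $w^*(c)$ is the weak-$*$ topology on $\ell_1$ induced by $c$ through this identification, and $w$ is the weak topology of $\ell_1$. $B_{\ell_1}$ and $S_{\ell_1}$ are the closed unit ball and unit sphere of $\ell_1$, and $B_{\ell_1}$ carries the relative topologies. A point of continuity of $I$ is a point of $B_{\ell_1}$ at which $I$ is continuous. *)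

(* Defs.v *)
From HB Require Import structures.
From mathcomp Require Import all_boot all_order all_algebra.
From mathcomp Require Import all_classical all_reals all_analysis.

Set Implicit Arguments.
Unset Strict Implicit.
Unset Printing Implicit Defensive.

Import Order.TTheory GRing.Theory Num.Theory.
Import numFieldNormedType.Exports.

Local Open Scope classical_set_scope.
Local Open Scope ring_scope.

(** Sequences are indexed from 0: the informal $a_1, a_2, \dots$ are
    [a 0%N, a 1%N, ...]. *)

Section ell1.
Context {R : realType}.

Definition is_ell1 : {pred (nat -> R)} :=
  [pred a : nat -> R | `[< cvgn (series (fun n => `|a n|)) >]].

Lemma is_ell1P (a : nat -> R) :
  reflect (cvgn (series (fun n => `|a n|))) (a \in is_ell1).
Proof. exact: asboolP. Qed.

Lemma is_ell1_submod_closed : submod_closed is_ell1.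
Proof.
split=> [|k a b /is_ell1P ca /is_ell1P cb]; apply/is_ell1P.
  rewrite (_ : (fun n => _) = 0 *: (fun n : nat => 0 : R)); last first.
    by rewrite scale0r funeqE => n /=; rewrite normr0.
  apply: is_cvg_seriesZ.
  rewrite (_ : series _ = fun=> 0); first exact: is_cvg_cst.
  by rewrite funeqE => n; rewrite /series /= big1.
have := is_cvg_seriesD (@is_cvg_seriesZ _ _ `|k| ca) cb.
apply: series_le_cvg => n //=.
- by rewrite addr_ge0// mulr_ge0.
- by apply: (le_trans (ler_normD _ _)); rewrite normrM.
Qed.

HB.instance Definition _ :=
  GRing.isSubmodClosed.Build R (nat -> R) is_ell1 is_ell1_submod_closed.

End ell1.

Record ell1 (R : realType) : Type := Ell1 {
  ell1_seq :> nat -> R;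
  ell1_subproof : ell1_seq \in is_ell1 }.

Section ell1_normed.
Context {R : realType}.

HB.instance Definition _ := [isSub for @ell1_seq R].
HB.instance Definition _ := [Choice of ell1 R by <:].
HB.instance Definition _ := [SubChoice_isSubLmodule of ell1 R by <:].

Lemma ell1_cvg (a : ell1 R) : cvgn (series (fun n => `|a n|)).
Proof. exact/is_ell1P/(ell1_subproof a). Qed.

Definition ell1_norm (a : ell1 R) : R := limn (series (fun n => `|a n|)).

Lemma ell1_normD (a b : ell1 R) :
  ell1_norm (a + b) <= ell1_norm a + ell1_norm b.
Proof.
rewrite /ell1_norm -lim_seriesD; [|exact: ell1_cvg..].
apply: lim_series_le; first exact: ell1_cvg.
  by apply: is_cvg_seriesD; exact: ell1_cvg.
by move=> n; exact: ler_normD.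
Qed.

Lemma ell1_normZ (k : R) (a : ell1 R) :
  ell1_norm (k *: a) = `|k| * ell1_norm a.
Proof.
rewrite /ell1_norm -[RHS]/(`|k| *: _) -lim_seriesZ; last exact: ell1_cvg.
by congr (limn (series _)); rewrite funeqE => n /=; rewrite normrM.
Qed.

Lemma ell1_le_norm (a : ell1 R) n : `|a n| <= ell1_norm a.
Proof.
apply: (@le_trans _ _ (series (fun n => `|a n|) n.+1)).
  by rewrite /series /= big_nat_recr//= lerDr sumr_ge0.
apply: nondecreasing_cvgn_le; last exact: ell1_cvg.
exact: nondecreasing_series.
Qed.

Lemma ell1_norm0_eq0 (a : ell1 R) : ell1_norm a = 0 -> a = 0.
Proof.
move=> a0; apply: val_inj; rewrite funeqE => n /=; apply/eqP.
by rewrite -normr_le0 -a0 ell1_le_norm.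
Qed.

HB.instance Definition _ := Lmodule_isNormed.Build R (ell1 R)
  ell1_normD ell1_normZ ell1_norm0_eq0.

End ell1_normed.

Section cseq.
Context {R : realType}.

Definition is_cseq : {pred (nat -> R)} := [pred x : nat -> R | `[< cvgn x >]].

Lemma is_cseqP (x : nat -> R) : reflect (cvgn x) (x \in is_cseq).
Proof. exact: asboolP. Qed.

Lemma is_cseq_submod_closed : submod_closed is_cseq.
Proof.
split=> [|k x y /is_cseqP cx /is_cseqP cy]; apply/is_cseqP.
  exact: is_cvg_cst.
by apply: is_cvgD => //; exact: is_cvgZl_tmp.
Qed.

HB.instance Definition _ :=
  GRing.isSubmodClosed.Build R (nat -> R) is_cseq is_cseq_submod_closed.

End cseq.

Record cseq (R : realType) : Type := Cseq {
  cseq_seq :> nat -> R;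
  cseq_subproof : cseq_seq \in is_cseq }.

Section cseq_normed.
Context {R : realType}.

HB.instance Definition _ := [isSub for @cseq_seq R].
HB.instance Definition _ := [Choice of cseq R by <:].
HB.instance Definition _ := [SubChoice_isSubLmodule of cseq R by <:].

Lemma cseq_cvg (x : cseq R) : cvgn x.
Proof. exact/is_cseqP/(cseq_subproof x). Qed.

Definition cseq_norm (x : cseq R) : R := sup (range (fun n => `|x n|)).

Lemma cseq_has_ubound (x : cseq R) : has_ubound (range (fun n => `|x n|)).
Proof.
have [M _ /= xM] := pinfty_ex_gt0 (cvg_seq_bounded (@cseq_cvg x)).
by exists M => _ [n _ <-]; exact: xM.
Qed.

Lemma cseq_le_norm (x : cseq R) n : `|x n| <= cseq_norm x.
Proof. by apply: ub_le_sup; [exact: cseq_has_ubound|exists n]. Qed.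

Lemma cseq_norm_le (x : cseq R) (M : R) :
  (forall n, `|x n| <= M) -> cseq_norm x <= M.
Proof.
move=> xM; apply: ge_sup; first by exists `|x 0%N|; exists 0%N.
by move=> _ [n _ <-].
Qed.

Lemma cseq_normD (x y : cseq R) :
  cseq_norm (x + y) <= cseq_norm x + cseq_norm y.
Proof.
apply: cseq_norm_le => n; apply: (le_trans (ler_normD _ _)).
by rewrite lerD// cseq_le_norm.
Qed.

Lemma cseq_normZ (k : R) (x : cseq R) :
  cseq_norm (k *: x) = `|k| * cseq_norm x.
Proof.
have le_ (l : R) (y : cseq R) : cseq_norm (l *: y) <= `|l| * cseq_norm y.
  by apply: cseq_norm_le => n; rewrite normrM ler_wpM2l// cseq_le_norm.
apply/eqP; rewrite eq_le le_ /=.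
have [->|k0] := eqVneq k 0.
  by rewrite normr0 mul0r (le_trans _ (cseq_le_norm _ 0%N)).
have := le_ k^-1 (k *: x).
by rewrite scalerA mulVf// scale1r normfV ler_pdivlMl ?normr_gt0.
Qed.

Lemma cseq_norm0_eq0 (x : cseq R) : cseq_norm x = 0 -> x = 0.
Proof.
move=> x0; apply: val_inj; rewrite funeqE => n /=; apply/eqP.
by rewrite -normr_le0 -x0 cseq_le_norm.
Qed.

HB.instance Definition _ := Lmodule_isNormed.Build R (cseq R)
  cseq_normD cseq_normZ cseq_norm0_eq0.

End cseq_normed.

Section dual.
Context {R : realType}.

Record dual (E : normedModType R) : Type := Dual {
  dual_fun :> {scalar E};
  dual_continuous : continuous (dual_fun : E -> R) }.

HB.instance Definition _ (E : normedModType R) := gen_eqMixin (dual E).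
HB.instance Definition _ (E : normedModType R) := gen_choiceMixin (dual E).

Definition weak (E : normedModType R) : Type :=
  initial_topology ((fun x f => f x) : E -> {ptws dual E -> R}).

HB.instance Definition _ (E : normedModType R) := Topological.on (weak E).

Definition weak_star (E : normedModType R) : Type :=
  initial_topology ((fun f x => f x) : dual E -> {ptws E -> R}).

HB.instance Definition _ (E : normedModType R) := Topological.on (weak_star E).

End dual.

Section ell1_dual_c.
Context {R : realType}.

(** $a_1 \lim_n \alpha_n + \sum_{n \ge 1} a_{n+1} \alpha_n$, with both
    sequences shifted to start at index 0. *)
Definition c_pairing (a : ell1 R) (x : cseq R) : R :=
  a 0%N * limn x + limn (series (fun n => a n.+1 * x n)).

Lemma ell1_tail_cvg (a : ell1 R) : cvgn (series (fun n => `|a n.+1|)).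
Proof.
apply: nondecreasing_is_cvgn; first exact: nondecreasing_series.
exists (ell1_norm a) => _ [n _ <-].
have le1 : series (fun n => `|a n.+1|) n <= series (fun n => `|a n|) n.+1.
  by rewrite /series /= [leRHS]big_nat_recl//= lerDr.
apply: (le_trans le1); apply: nondecreasing_cvgn_le; last exact: ell1_cvg.
exact: nondecreasing_series.
Qed.

Lemma c_pairing_normed_cvg (a : ell1 R) (x : cseq R) :
  cvgn (series (fun n => `|a n.+1 * x n|)).
Proof.
have := @is_cvg_seriesZ _ _ (cseq_norm x) (@ell1_tail_cvg a).
apply: series_le_cvg => n //=.
- by rewrite mulr_ge0// (le_trans _ (cseq_le_norm x 0%N)).
- by rewrite normrM mulrC ler_wpM2r// cseq_le_norm.
Qed.

Lemma c_pairing_cvg (a : ell1 R) (x : cseq R) :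
  cvgn (series (fun n => a n.+1 * x n)).
Proof. exact/normed_cvg/c_pairing_normed_cvg. Qed.

Lemma c_pairing_is_scalar (a : ell1 R) : scalar (c_pairing a).
Proof.
move=> k x y; rewrite /c_pairing.
have -> : limn (k *: x + y : cseq R) = k * limn x + limn y.
  have cx := @cseq_cvg _ x; have cy := @cseq_cvg _ y.
  rewrite -[k * limn x]/(k *: limn x) -limZl_tmp// -limD//.
  exact: is_cvgZl_tmp.
have -> : limn (series (fun n => a n.+1 * (k *: x + y : cseq R) n)) =
    k * limn (series (fun n => a n.+1 * x n)) +
    limn (series (fun n => a n.+1 * y n)).
  have cx := @c_pairing_cvg a x; have cy := @c_pairing_cvg a y.
  rewrite -[k * limn _]/(k *: limn _) -lim_seriesZ// -lim_seriesD//; last first.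
    exact: is_cvg_seriesZ.
  congr (limn (series _)); rewrite funeqE => n /=.
  by rewrite -[LHS]/(a n.+1 * (k * x n + y n)) mulrDr mulrCA.
by rewrite !mulrDr mulrCA addrACA.
Qed.

HB.instance Definition _ (a : ell1 R) :=
  GRing.isLinear.Build R (cseq R) R *%R (c_pairing a) (c_pairing_is_scalar a).

Lemma c_pairing_le (a : ell1 R) (x : cseq R) :
  `|c_pairing a x| <= `|a| * `|x|.
Proof.
have split_norm : ell1_norm a = `|a 0%N| + limn (series (fun n => `|a n.+1|)).
  apply: cvg_lim => //.
  rewrite -cvg_shiftS.
  rewrite (_ : (fun n => _) =
     (fun n => `|a 0%N| + series (fun n => `|a n.+1|) n)); last first.
    by rewrite funeqE => n; rewrite /series /= big_nat_recl.
  by apply: cvgD; [exact: cvg_cst|exact: ell1_tail_cvg].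
rewrite -[`|a|]/(ell1_norm a) -[`|x|]/(cseq_norm x) split_norm mulrDl.
apply: (le_trans (ler_normD _ _)); apply: lerD.
  rewrite normrM ler_wpM2l// -lim_norm; last exact: cseq_cvg.
  apply: limr_le; first by apply: is_cvg_norm; exact: cseq_cvg.
  by apply: nearW => n; exact: cseq_le_norm.
apply: (le_trans (lim_series_norm (@c_pairing_normed_cvg a x))).
rewrite mulrC -[leRHS]/(cseq_norm x *: _) -lim_seriesZ; last exact: ell1_tail_cvg.
apply: lim_series_le; first exact: c_pairing_normed_cvg.
  by apply: is_cvg_seriesZ; exact: ell1_tail_cvg.
by move=> n; rewrite /= normrM mulrC ler_wpM2r// cseq_le_norm.
Qed.

Lemma c_pairing_continuous (a : ell1 R) :
  continuous (c_pairing a : cseq R -> R).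
Proof.
apply: bounded_linear_continuous; apply/linear_boundedP.
exists `|a|; split; first exact: num_real.
move=> M aM x; apply: (le_trans (c_pairing_le a x)).
by rewrite ler_wpM2r// ltW.
Qed.

Definition ell1_to_dual_c (a : ell1 R) : dual (cseq R) :=
  Dual (@c_pairing_continuous a).

End ell1_dual_c.

(** The topology $w^*(c)$ on $\ell_1$. *)
Definition ell1_wstar (R : realType) : Type :=
  initial_topology (@ell1_to_dual_c R : ell1 R -> weak_star (cseq R)).

HB.instance Definition _ (R : realType) := Topological.on (ell1_wstar R).

Definition ell1_ball (R : realType) : set (ell1 R) := [set a | `|a| <= 1].
Definition ell1_sphere (R : realType) : set (ell1 R) := [set a | `|a| = 1].

(** The ball as a topological space, with the relative topologies of [w^*(c)]
    and [w] respectively; the two types have the same elements. *)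
Definition ball_wstar (R : realType) : topologicalType :=
  set_type (@ell1_ball R : set (ell1_wstar R)).
Definition ball_w (R : realType) : topologicalType :=
  set_type (@ell1_ball R : set (weak (ell1 R))).

Definition ball_id (R : realType) : ball_wstar R -> ball_w R := fun x => x.

Definition ball_val (R : realType) (x : ball_wstar R) : ell1 R := set_val x.

Definition points_of_continuity (X Y : topologicalType) (f : X -> Y) : set X :=
  [set x | {for x, continuous f}].

(* Main.v *)
(** Testing against the unit sequences of [c], [w*(c)]-convergence implies
    convergence of every coordinate except the first.  If [|a| = 1] and
    [a_1 = 0], finitely many of these coordinates carry almost all the norm of
    [a], so a point of the ball that is close to [a] there has little mass left
    elsewhere: [w*(c)]-convergence to [a] in the ball is norm convergence.
    Otherwise some [s <> 0] satisfies [|a - s e_1| + |s| <= 1], and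
    [a - s e_1 + s e_n] stays in the ball and tends [w*(c)] to [a], since
    evaluation at [n] tends to the limit functional, while its first coordinate
    is [a_1 - s] for all [n > 1]. *)

From HB Require Import structures.
Require Import Defs.
From mathcomp Require Import all_boot all_order all_algebra.
From mathcomp Require Import all_classical all_reals all_analysis.
From mathcomp Require Import ring lra.

Set Implicit Arguments.
Unset Strict Implicit.
Unset Printing Implicit Defensive.

Import Order.TTheory GRing.Theory Num.Theory.
Import numFieldNormedType.Exports.

Local Open Scope classical_set_scope.
Local Open Scope ring_scope.

(** [weak], [weak_star], [ell1_wstar] and the relative topologies on the ball are all initial;
    iterating this equivalence turns convergence in them into convergence of scalars. *)
Lemma cvg_initialP (S : choiceType) (T : topologicalType) (f : S -> T)
    (F : set_system S) (s : S) : Filter F ->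
  F --> (s : initial_topology f) <-> f @ F --> f s.
Proof.
move=> FF; split=> [Fs|fFs].
  apply: cvg_comp; first exact: Fs.
  exact: (@initial_continuous _ _ f).
move=> A [_ [[B oB <-] Bfs sBA]].
by apply: (filterS sBA); apply: fFs; exact: open_nbhs_nbhs.
Qed.

Lemma cvg_ptwsP (U : Type) (V : topologicalType)
    (F : set_system {ptws U -> V}) (f : {ptws U -> V}) : Filter F ->
  F --> f <-> forall t, (fun g : {ptws U -> V} => g t) @ F --> f t.
Proof.
move=> FF; rewrite cvg_sup; split=> Ff t.
  by have /cvg_initialP := Ff t.
by apply/cvg_initialP; exact: Ff.
Qed.

Section ell1_topologies.
Context {R : realType}.

Lemma cvg_weakP (E : normedModType R) (F : set_system E) (x : E) : Filter F ->
  F --> (x : weak E) <-> forall f : dual E, f @ F --> f x.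
Proof. by move=> FF; rewrite cvg_initialP cvg_ptwsP. Qed.

Lemma cvg_ell1_wstarP (F : set_system (ell1 R)) (a : ell1 R) : Filter F ->
  F --> (a : ell1_wstar R) <->
  forall x, c_pairing ^~ x @ F --> c_pairing a x.
Proof. by move=> FF; rewrite cvg_initialP cvg_initialP cvg_ptwsP. Qed.

Lemma cvg_series_indic (u : nat -> R) n :
  series (fun k => (k == n)%:R * u k) @ \oo --> u n.
Proof.
apply: cvg_near_cst; near=> m; rewrite /series /=.
have nm : (n < m)%N by near: m; exact: nbhs_infty_gt.
rewrite big_mkord (bigD1 (Ordinal nm)) //= eqxx mul1r big1 ?addr0// => i.
by rewrite -val_eqE /= => /negPf ->; rewrite mul0r.
Unshelve. all: by end_near. Qed.

Definition indic_seq n : nat -> R := fun k => (k == n)%:R.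

Lemma cvg_series_norm_indic_seq n :
  series (fun k => `|indic_seq n k|) @ \oo --> (1 : R).
Proof.
rewrite (_ : (fun k => _) = (fun k => (k == n)%:R * 1)).
  exact: (@cvg_series_indic (fun=> 1)).
by apply/funext => k; rewrite mulr1 normr_nat.
Qed.

Lemma cvg_indic_seq n : indic_seq n @ \oo --> (0 : R).
Proof.
apply: cvg_near_cst; near=> m; rewrite /indic_seq gtn_eqF//.
by near: m; exact: nbhs_infty_gt.
Unshelve. all: by end_near. Qed.

Lemma indic_seq_is_ell1 n : indic_seq n \in is_ell1.
Proof. by apply/is_ell1P/cvgP; exact: cvg_series_norm_indic_seq. Qed.

Lemma indic_seq_is_cseq n : indic_seq n \in is_cseq.
Proof. by apply/is_cseqP/cvgP; exact: cvg_indic_seq. Qed.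

Definition ell1_basis n : ell1 R := Ell1 (indic_seq_is_ell1 n).
Definition cseq_basis n : cseq R := Cseq (indic_seq_is_cseq n).

Lemma ell1_basis_norm n : `|ell1_basis n| = 1.
Proof. by apply: cvg_lim => //; exact: cvg_series_norm_indic_seq. Qed.

(** A unit sequence tends to 0, which kills the limit term: such tests see every coordinate of [a]
    except [a 0]. *)
Lemma c_pairing_cseq_basis (a : ell1 R) n : c_pairing a (cseq_basis n) = a n.+1.
Proof.
rewrite /c_pairing (cvg_lim _ (@cvg_indic_seq n))// mulr0 add0r.
have <- : (fun k => (k == n)%:R * a k.+1) = (fun k => a k.+1 * cseq_basis n k).
  by apply/funext => k; rewrite mulrC.
by apply: cvg_lim => //; exact: (@cvg_series_indic (fun k => a k.+1)).
Qed.

Lemma c_pairing_ell1_basis0 (x : cseq R) :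
  c_pairing (ell1_basis 0) x = limn x.
Proof.
rewrite /c_pairing mul1r (_ : series _ = fun=> 0) ?lim_cst ?addr0//.
by apply/funext => n; rewrite /series /= big1// => k _; rewrite mul0r.
Qed.

Lemma c_pairing_ell1_basisS n (x : cseq R) :
  c_pairing (ell1_basis n.+1) x = x n.
Proof.
rewrite /c_pairing mul0r add0r; apply: cvg_lim => //.
exact: (@cvg_series_indic x).
Qed.

Lemma c_pairing_linearl (x : cseq R) :
  linear_for *%R (fun a : ell1 R => c_pairing a x).
Proof.
move=> k a b; rewrite /c_pairing.
have ca := @c_pairing_cvg _ a x; have cb := @c_pairing_cvg _ b x.
have -> : (fun n => (k *: a + b : ell1 R) n.+1 * x n) =
    k *: (fun n => a n.+1 * x n) + (fun n => b n.+1 * x n).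
  apply/funext => n.
  by rewrite -[LHS]/((k * a n.+1 + b n.+1) * x n) mulrDl -mulrA.
rewrite lim_seriesD//; last exact: is_cvg_seriesZ.
rewrite lim_seriesZ// -[(k *: a + b) 0%N]/(k * a 0%N + b 0%N).
by rewrite -[k *: limn _]/(k * limn _); ring.
Qed.

Lemma ell1_normE (a : ell1 R) :
  `|a| = `|a 0%N| + limn (series (fun n => `|a n.+1|)).
Proof.
apply: cvg_lim => //; rewrite -cvg_shiftS.
rewrite (_ : (fun n => _) =
    (fun n => `|a 0%N| + series (fun n => `|a n.+1|) n)); last first.
  by apply/funext => n; rewrite /series /= big_nat_recl.
by apply: cvgD; [exact: cvg_cst|exact: ell1_tail_cvg].
Qed.

Lemma ell1_series_le_norm (a : ell1 R) n : series (fun k => `|a k|) n <= `|a|.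
Proof.
apply: nondecreasing_cvgn_le; last exact: ell1_cvg.
exact: nondecreasing_series.
Qed.

(* Summing [|b k - a k| <= |b k| + |a k|] off the block [1..N] and
   [|a k| <= |b k| + |b k - a k|] on it. *)
Lemma ell1_dist_le (a b : ell1 R) N :
  `|b - a| <= `|b| + `|a| +
    2 * \sum_(0 <= k < N) (`|b k.+1 - a k.+1| - `|a k.+1|).
Proof.
set S := \sum_(_ <= _ < _) _.
apply: limr_le; first exact: ell1_cvg.
(* The sums split into index 0, the block [1..N] and [k] further indices; the correction [2 * S]
   comes from the block alone. *)
near=> m; have [k ->] : exists k, m = (N + k).+1.
  exists (m - N.+1)%N; rewrite -addSn subnKC//.
  by near: m; exact: nbhs_infty_gt.
have : series (fun i => `|(b - a) i|) (N + k).+1 <=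
    series (fun i => `|b i|) (N + k).+1 + series (fun i => `|a i|) (N + k).+1
    + 2 * S.
  have abD i : `|(b - a) i| <= `|b i| + `|a i| by exact: ler_normB.
  have abD2 i : `|(b - a) i| <= `|b i| + `|a i| + 2 * (`|b i - a i| - `|a i|).
    have := ler_normB (b i) (b i - a i); rewrite subKr.
    by rewrite (_ : (b - a) i = b i - a i)//; lra.
  rewrite /series /= !big_nat_recl//.
  rewrite !(@big_cat_nat _ _ _ N 0 (N + k)%N)//= ?leq_addr//.
  have h1 : \sum_(0 <= i < N) `|(b - a) i.+1| <=
      \sum_(0 <= i < N) `|b i.+1| + \sum_(0 <= i < N) `|a i.+1| + 2 * S.
    rewrite /S mulr_sumr -!big_split /=; apply: ler_sum => i _.
    exact: abD2.
  have h2 : \sum_(N <= i < N + k) `|(b - a) i.+1| <=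
      \sum_(N <= i < N + k) `|b i.+1| + \sum_(N <= i < N + k) `|a i.+1|.
    by rewrite -big_split; apply: ler_sum => i _; exact: abD.
  by have := abD 0%N; lra.
have := ell1_series_le_norm a (N + k).+1.
have := ell1_series_le_norm b (N + k).+1.
by lra.
Unshelve. all: by end_near. Qed.

(** Named so as to carry a linear structure; coordinate 0 will be the functional that detects weak
    discontinuity. *)
Definition ell1_coord n (a : ell1 R) : R := a n.

Lemma ell1_coord_is_scalar n : scalar (ell1_coord n).
Proof. by []. Qed.

HB.instance Definition _ n :=
  GRing.isLinear.Build R (ell1 R) R *%R (ell1_coord n) (ell1_coord_is_scalar n).

Lemma ell1_coord_continuous n : continuous (ell1_coord n : ell1 R -> R).
Proof.
apply: bounded_linear_continuous; apply/linear_boundedP.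
exists 1; split; first exact: num_real.
move=> M M1 a; apply: le_trans (ell1_le_norm a n) _.
by rewrite -[ell1_norm a]/(`|a|) ler_peMl// ltW.
Qed.

Definition ell1_coord_dual n : dual (ell1 R) := Dual (@ell1_coord_continuous n).

Lemma cvg_ball_wstarP (T : Type) (F : set_system T) (g : T -> ball_wstar R)
    (a : ball_wstar R) : Filter F ->
  g @ F --> a <->
  forall x,
    c_pairing (ball_val (g t)) x @[t --> F] --> c_pairing (ball_val a) x.
Proof. by move=> FF; rewrite cvg_initialP cvg_ell1_wstarP. Qed.

Lemma cvg_ball_wP (T : Type) (F : set_system T) (g : T -> ball_wstar R)
    (a : ball_wstar R) : Filter F ->
  (fun t => ball_id (g t)) @ F --> ball_id a <->
  forall f : dual (ell1 R), f (ball_val (g t)) @[t --> F] --> f (ball_val a).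
Proof. by move=> FF; rewrite cvg_initialP cvg_weakP. Qed.

Lemma ball_valP (a : ball_wstar R) : `|ball_val a| <= 1.
Proof. exact: set_valP a. Qed.

(** No mass can escape: a finite block carries nearly all of [|a|], [g t] is close to [a] on it, and
    [|g t| <= |a|] leaves little for the other coordinates. *)
Lemma ell1_cvg_of_coord (T : Type) (F : set_system T) (g : T -> ell1 R)
    (a : ell1 R) : Filter F ->
  (forall t, `|g t| <= `|a|) -> a 0%N = 0 ->
  (forall k, g t k.+1 @[t --> F] --> a k.+1) -> g @ F --> a.
Proof.
move=> FF ga a0 gka; apply/cvgrPdistC_lt => e e0.
(* As [a 0 = 0], the series from index 1 on already sums to [|a|]. *)
have [N aN] : exists N, `|a| - e / 4 < \sum_(0 <= k < N) `|a k.+1|.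
  have := @ell1_tail_cvg _ a => /cvgrPdist_lt/(_ (e / 4)).
  rewrite divr_gt0// => /(_ isT) [N _ /(_ N (leqnn N))] h; exists N.
  move: h; rewrite ell1_normE a0 normr0 /series /= ltr_norml => /andP[_].
  by lra.
have /cvgrPdistC_lt/(_ (e / 4)) : \sum_(0 <= k < N)
    `|g t k.+1 - a k.+1| @[t --> F] --> \sum_(0 <= k < N) (0 : R).
  apply: cvg_big => [|k _]; first exact: add_continuous.
  rewrite -(normr0 R) -(subrr (a k.+1)).
  by apply: cvg_norm; apply: cvgB; [exact: gka|exact: cvg_cst].
rewrite divr_gt0// => /(_ isT); apply: filterS => t.
rewrite big1_eq subr0 ltr_norml => /andP[_ gt].
(* The bound is less than [2 * |a| + 2 * (e / 4 - (|a| - e / 4)) = e]. *)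
apply: le_lt_trans (ell1_dist_le _ _ N) _; rewrite sumrB.
by have := ga t; lra.
Qed.

Lemma ell1_ball_room_for_shift (a : ell1 R) :
  `|a| <= 1 -> ~ (`|a| = 1 /\ a 0%N = 0) ->
  exists2 s : R, s != 0 & `|a - s *: ell1_basis 0| + `|s| <= 1.
Proof.
move=> a1 na; have [a0|a0] := eqVneq (a 0%N) 0; last first.
  (* Deleting coordinate 0 lowers the norm by exactly [|s|]. *)
  exists (a 0%N) => //.
  set d := a - _; have dE k : d k = a k - a 0%N * indic_seq 0 k by [].
  rewrite ell1_normE dE /indic_seq eqxx mulr1 subrr normr0 add0r.
  under [fun n => `|d n.+1|]eq_fun do rewrite dE /indic_seq mulr0 subr0.
  by rewrite addrC -ell1_normE.
have alt : `|a| < 1 by rewrite lt_neqAle a1 andbT; apply/eqP => ?; exact: na.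
(* Half the gap to 1, because [|s|] is paid twice: once in the norm of the difference and once as
   the added term. *)
exists ((1 - `|a|) / 2); first by rewrite gt_eqF// divr_gt0// subr_gt0.
have := ler_normB a (((1 - `|a|) / 2) *: ell1_basis 0).
rewrite normrZ ell1_basis_norm mulr1 [`|(1 - _) / 2|]ger0_norm; last first.
  by rewrite divr_ge0// subr_ge0.
by lra.
Qed.

Lemma continuity_point_in_sphere (a : ball_wstar R) :
  {for a, continuous (@ball_id R)} -> `|ball_val a| = 1 /\ ball_val a 0%N = 0.
Proof.
move=> ca; apply: contrapT => na.
have [s s0 sa] := ell1_ball_room_for_shift (ball_valP a) na.
(* Nested in the shape [k *: a + b] to which [c_pairing_linearl] applies twice. *)
pose u n := s *: ell1_basis n.+1 + (- s *: ell1_basis 0 + ball_val a).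
have uB n : u n \in (@ell1_ball R).
  rewrite inE; apply: le_trans sa; apply: le_trans (ler_normD _ _) _.
  rewrite normrZ ell1_basis_norm mulr1 scaleNr [- _ + _]addrC.
  by rewrite [leLHS]addrC lexx.
pose v n : ball_wstar R := exist _ (u n) (uB n).
have va : v @ \oo --> a.
  apply/cvg_ball_wstarP => x.
  have -> : (fun n => c_pairing (ball_val (v n)) x) =
      fun n => s * x n + (- s * limn x + c_pairing (ball_val a) x).
    apply/funext => n; rewrite -[ball_val _]/(u n) !c_pairing_linearl.
    by rewrite c_pairing_ell1_basisS c_pairing_ell1_basis0.
  rewrite -[X in _ --> X](addNKr (s * limn x)) mulNr.
  apply: cvgD; last exact: cvg_cst.
  by apply: cvgM; [exact: cvg_cst|exact: cseq_cvg].
(* Coordinate 0 is constantly [a 0 - s] along [v], so weak convergence to [a] would force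
   [s = 0]. *)
have /cvg_ball_wP/(_ (ell1_coord_dual 0)) :
    (fun n => ball_id (v n)) @ \oo --> ball_id a.
  exact: (cvg_comp _ _ va ca).
have -> : (fun n => ell1_coord_dual 0 (ball_val (v n))) =
    fun=> ball_val a 0%N - s.
  apply/funext => n.
  rewrite -[LHS]/(s * 0 + (- s * 1 + ball_val a 0%N)).
  by rewrite mulr0 add0r mulr1 addrC.
move=> /cvg_lim => /(_ (@Rhausdorff R)); rewrite lim_cst//= => as0.
by move/eqP: s0; apply; have : ball_val a 0%N - s = ball_val a 0%N := as0; lra.
Qed.

End ell1_topologies.

Theorem theorem4p4 (R : realType) :
  let Theta : set (ell1 R) := [set a : ell1 R | ell1_sphere a /\ a 0%N = 0] in
  Theta = @ball_val R @` points_of_continuity (@ball_id R).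
Proof.
move=> Theta; apply/seteqP; split=> [a [a1 a0]|_ [a ca <-]]; last first.
  exact: continuity_point_in_sphere.
have aB : a \in (@ell1_ball R) by rewrite inE /ell1_ball /= a1.
pose b : ball_wstar R := exist _ a aB; exists b => //.
have bF : Filter (nbhs b) := nbhs_filter b.
apply/(@cvg_ball_wP R _ (nbhs b) id b bF) => f.
(* It suffices that [ball_val] converges in norm along the [w*(c)] neighbourhoods of [b]. *)
apply: (cvg_comp (@ball_val R) f); last exact: (@dual_continuous _ _ f).
apply: ell1_cvg_of_coord => // [t|k]; first by rewrite a1; exact: ball_valP.
have /(@cvg_ball_wstarP R _ (nbhs b) id b bF)/(_ (cseq_basis k)) :
  id @ nbhs b --> b by exact: cvg_id.
by rewrite c_pairing_cseq_basis; under eq_fun do rewrite c_pairing_cseq_basis.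
Qed.
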